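(* Let $\mathbb{X}$ be a perfect compact metric space and let $f:\mathbb{X}\to\mathbb{X}$ be a Borel measurable map. If $\mu$ is an $f$-invariant finite Borel measure, then for $\mu$-almost every $x\in\mathbb{X}$ the measure $\eta_x$ is an $f$-invariant ergodic probability measure. Furthermore $\mu=\int_{x\in\mathbb{X}}\eta_x\,d\mu$, that is, $$\int\varphi\,d\mu=\int_{x\in\mathbb{X}}\Big(\int\varphi\,d\eta_x\Big)\,d\mu(x)$$ for every $\varphi\in L^1(\mu)$; in particular $\mu(V)=\int_{x\in\mathbb{X}}\eta_x(V)\,d\mu(x)$ for every Borel set $V\subset\mathbb{X}$.
   Context: A metric space is perfect if it has no isolated points. For $x\in\mathbb{X}$ and any $A\subset\mathbb{X}$ let $\tau_x(A)=\limsup_{n\to\infty}\frac1n\sum_{j=0}^{n-1}\chi_A(f^j(x))$. For $Y\subset\mathbb{X}$ and $r>0$ let $\nu_r(Y)=\inf\sum_{I\in\mathcal I}\tau_x(I)$, where the infimum is over all countable covers $\mathcal I$ of $Y$ by open subsets of $\mathbb{X}$ each of diameter at most $r$, and let $\nu(Y)=\sup_{r>0}\nu_r(Y)$ (Carathéodory's Method II metric outer measure built from the premeasure $\tau_x$ on open sets). The measure $\eta_x$ is the restriction of $\nu$ to the Borel $\sigma$-algebra; it is a countably additive Borel measure, possibly with infinite total mass. *)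

(* Defs.v *)
From HB Require Import structures.
From mathcomp Require Import all_boot all_order all_algebra.
From mathcomp Require Import all_classical all_reals all_analysis.
Set Implicit Arguments. Unset Strict Implicit. Unset Printing Implicit Defensive.
Import Order.TTheory GRing.Theory Num.Theory.
Local Open Scope classical_set_scope.
Local Open Scope ring_scope.

Section MetricDefs.
Variables (R : realType) (T : pointedType) (dist : T -> T -> R).

Definition is_metric : Prop :=
  [/\ forall x y, 0 <= dist x y,
      forall x y, dist x y = 0 <-> x = y,
      forall x y, dist x y = dist y x &
      forall x y z, dist x z <= dist x y + dist y z].

Definition metric_open (U : set T) : Prop :=
  forall x, U x -> exists e : R, 0 < e /\ forall y, dist x y < e -> U y.

Definition metric_compact : Prop :=
  forall C : set (set T), (forall U, C U -> metric_open U) ->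
    (forall x, exists U, C U /\ U x) ->
    exists F : set (set T), [/\ finite_set F, F `<=` C &
                                forall x, exists U, F U /\ U x].

Definition metric_perfect : Prop :=
  forall x (e : R), 0 < e -> exists y, y <> x /\ dist x y < e.

Definition diam_le (A : set T) (r : R) : Prop :=
  forall x y, A x -> A y -> dist x y <= r.

Definition borel := g_sigma_algebraType metric_open.

Definition tau (f : T -> T) (x : T) (A : set T) : \bar R :=
  limn_esup (fun n : nat =>
    ((n.+1%:R)^-1 * \sum_(j < n.+1) \1_A (iter j f x))%:E).

Definition nu_r (f : T -> T) (x : T) (r : R) (Y : set T) : \bar R :=
  ereal_inf [set (\sum_(0 <= n <oo) tau f x (I n))%E | I in
     [set I : nat -> set T | (forall n, metric_open (I n) /\ diam_le (I n) r)
                              /\ Y `<=` \bigcup_n I n]].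

(* nu(Y) = sup_{r>0} nu_r(Y); eta_x is its restriction to Borel sets *)
Definition nu (f : T -> T) (x : T) (Y : set T) : \bar R :=
  ereal_sup [set nu_r f x r Y | r in [set r : R | 0 < r]].

End MetricDefs.

Definition invariant_ergodic_probability (R : realType) (T : pointedType)
    (dist : T -> T -> R) (f : T -> T) (m : set (borel dist) -> \bar R) : Prop :=
  [/\ m set0 = 0%E,
      forall A : set (borel dist), measurable A -> (0 <= m A)%E,
      semi_sigma_additive m &
      m setT = 1%E] /\ [/\ 
forall A : set (borel dist), measurable A -> m (f @^-1` A) = m A &
      forall A : set (borel dist), measurable A -> f @^-1` A = A ->
        m A = 0%E \/ m A = 1%E].

(* Main.v *)
(* Let tau_x(A) be the upper frequency with which the orbit of x visits A. The
   limsup half of Birkhoff's theorem gives \int tau_x(A) dmu(x) <= mu(A) for every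
   finite invariant mu. Given a Borel set A, cut it into finitely many pieces
   of small diameter and thicken these to open sets without adding more than e
   to the measure: the sum h of the frequencies of the thickened pieces bounds
   both tau_x(A) and nu_r(A), and \int h dmu <= mu(A) + e. Letting e and r tend to 0,
   tau_x(A) and nu_x(A) have a common majorant h_A with \int h_A dmu <= mu(A). By
   compactness nu_x(T) >= 1, so
     1 <= nu_x(A) + nu_x(~A) <= h_A(x) + h_{~A}(x),
   and likewise for tau_x; since the right-hand side has integral at most mu(T),
   nu_x(A) = tau_x(A) = h_A(x) for almost every x and \int nu_x(A) dmu(x) = mu(A).
   Using this for the members C of a countable generating pi-system, for their
   preimages and for the level sets {y | tau_y(C) > q}, which are invariant,
   one gets for almost every x that nu_x is an invariant probability measure with
   tau_y(C) >= nu_x(C) for nu_x-almost every y. Then Birkhoff's inequality for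
   nu_x shows nu_x(A `&` C) >= nu_x(A) nu_x(C) for invariant A; with the same
   for ~A, this is an equality, hence holds for C = A. *)

Require Import Defs.
From HB Require Import structures.
From mathcomp Require Import all_boot all_order all_algebra.
From mathcomp Require Import all_classical all_reals all_analysis.
From mathcomp Require Import measurable_realfun.
From mathcomp Require Import ring lra.
Set Implicit Arguments.
Unset Strict Implicit.
Unset Printing Implicit Defensive.
Import Order.TTheory GRing.Theory Num.Theory.
Import numFieldNormedType.Exports.
Local Open Scope classical_set_scope.
Local Open Scope ring_scope.
Local Open Scope ereal_scope.

(** * Upper limits of extended real sequences *)

Section limn_esup_real.
Context {R : realType}.
Implicit Types u v : nat -> \bar R.

Lemma lee_of_addgt0 (x y : \bar R) :
  (forall e : R, (0 < e)%R -> x <= y + e%:E) -> x <= y.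
Proof. by move=> h; apply/lee_addgt0Pr. Qed.

Lemma limn_esup_le_near u c N :
  (forall n, (N <= n)%N -> u n <= c) -> limn_esup u <= c.
Proof.
move=> uc; rewrite /limn_esup limf_esupE; apply: ge_ereal_inf.
exists (ereal_sup [set u n | n in [set n | (N <= n)%N]]).
  by exists [set n | (N <= n)%N] => //; exists N.
by apply: ge_ereal_sup => _ [n /= Nn <-]; exact: uc.
Qed.

Lemma limn_esup_lt u c :
  limn_esup u < c -> exists N, forall n, (N <= n)%N -> u n < c.
Proof.
rewrite /limn_esup limf_esupE => /ereal_inf_lt[_ [V [N _ NV] <-]] Vc.
exists N => n Nn; apply: le_lt_trans Vc.
by apply: ereal_sup_ubound; exists n => //; exact: NV.
Qed.

Lemma limn_esup_gt u c :
  c < limn_esup u -> forall N, exists2 n, (N <= n)%N & c < u n.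
Proof.
move=> cu N; apply/not_exists2P => h; move: cu; apply/negP; rewrite -leNgt.
apply: (@limn_esup_le_near _ _ N) => n Nn.
by have [//|/negP] := h n; rewrite -leNgt.
Qed.

End limn_esup_real.

(** * Visit counts and upper visit frequencies along an orbit *)

Section orbit_frequency.
Context {R : realType} {T : pointedType}.
Variable f : T -> T.
Implicit Types (A B : set T) (x : T).

Definition visits A n x : R := (\sum_(j < n) \1_A (iter j f x))%R.

(** Index [n] stands for a block of length [n.+1], as in [tau]. *)
Definition freq A n x : R := (n.+1%:R^-1 * visits A n.+1 x)%R.

Lemma tauE A x : tau R f x A = limn_esup (fun n => (freq A n x)%:E).
Proof. by []. Qed.

Lemma visits_ge0 A n x : (0 <= visits A n x)%R.
Proof. by apply: sumr_ge0. Qed.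

Lemma visits_le A n x : (visits A n x <= n%:R)%R.
Proof.
rewrite -[n in leRHS]card_ord -sum1_card natr_sum.
by apply: ler_sum => i _; rewrite indicE lern1 leq_b1.
Qed.

Lemma subset_visits A B n x : A `<=` B -> (visits A n x <= visits B n x)%R.
Proof.
move=> AB; apply: ler_sum => i _; rewrite !indicE ler_nat.
by case: (boolP (_ \in A)) => // /set_mem/AB/mem_set ->.
Qed.

Lemma visitsU A B n x :
  (visits (A `|` B) n x <= visits A n x + visits B n x)%R.
Proof.
rewrite -big_split; apply: ler_sum => i _ /=.
rewrite !indicE -natrD ler_nat in_setU.
by case: (_ \in A); case: (_ \in B).
Qed.

Lemma visitsD A m n x :
  visits A (m + n) x = (visits A m x + visits A n (iter m f x))%R.
Proof.
rewrite /visits big_split_ord /=; congr (_ + _)%R.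
by apply: eq_bigr => i _; rewrite addnC iterD.
Qed.

Lemma visits_preimage A n x : visits (f @^-1` A) n x = visits A n (f x).
Proof.
apply: eq_bigr => i _; rewrite !indicE -iterSr.
by congr (_%:R); congr nat_of_bool; apply/idP/idP; rewrite !inE.
Qed.

(** The orbit segments of length [n] from [x] and from [f x] differ by one end point each. *)
Lemma visits_shift A n x :
  (`|visits A n (f x) - visits A n x| <= 1)%R.
Proof.
have := visitsD A 1 n x; have := visitsD A n 1 x; rewrite addnC => ->.
have v1 y : visits A 1 y = \1_A y by rewrite /visits big_ord1.
rewrite /= !v1 => e.
have -> : (visits A n (f x) - visits A n x =
           \1_A (iter n f x) - \1_A x)%R.
  by rewrite -[visits A n (f x)](addKr (\1_A x)) -e; ring.
by rewrite !indicE; do 2![case: (_ \in A)];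
   rewrite ?subrr ?subr0 ?sub0r ?normrN ?normr0 ?normr1.
Qed.

Lemma tau_ge0 x A : 0 <= tau R f x A.
Proof.
rewrite tauE leNgt; apply/negP => /limn_esup_lt[N /(_ N (leqnn _))].
by rewrite lte_fin ltNge mulr_ge0 ?visits_ge0.
Qed.

Lemma tau_le1 x A : tau R f x A <= 1.
Proof.
apply: (@limn_esup_le_near _ _ _ 0%N) => n _.
by rewrite lee_fin mulrC ler_pdivrMr ?mul1r ?visits_le.
Qed.

Lemma tau_fin_num x A : tau R f x A \is a fin_num.
Proof.
by rewrite ge0_fin_numE ?tau_ge0// (le_lt_trans (tau_le1 _ _)) ?ltry.
Qed.

Lemma tau_setT x : tau R f x setT = 1.
Proof.
apply/eqP; rewrite eq_le tau_le1 leNgt; apply/negP => /limn_esup_lt.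
move=> [N /(_ N (leqnn _))]; rewrite lte_fin ltNge => /negP; apply.
rewrite (eq_bigr (fun=> 1%R)); last by move=> i _; rewrite indicT.
by rewrite sumr_const card_ord mulVf.
Qed.

Lemma tau_set0 x : tau R f x set0 = 0.
Proof.
apply/eqP; rewrite eq_le tau_ge0 andbT.
apply: (@limn_esup_le_near _ _ _ 0%N) => n _.
by rewrite lee_fin big1 ?mulr0// => i _; rewrite indic0.
Qed.

Lemma tau_near_lt x A (e : R) : (0 < e)%R -> exists N, forall n, (N <= n)%N ->
  (freq A n x < fine (tau R f x A) + e)%R.
Proof.
move=> e0; have : tau R f x A < (fine (tau R f x A) + e)%:E.
  by rewrite EFinD fineK ?tau_fin_num// lteDl ?tau_fin_num ?lte_fin.
by move=> /limn_esup_lt[N h]; exists N => n /h; rewrite lte_fin.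
Qed.

Lemma tauU x A B : tau R f x (A `|` B) <= tau R f x A + tau R f x B.
Proof.
rewrite [leLHS]tauE; apply: lee_of_addgt0 => e e0.
have e20 : (0 < e / 2)%R by rewrite divr_gt0.
have [N hN] := tau_near_lt x A e20; have [M hM] := tau_near_lt x B e20.
apply: (@limn_esup_le_near _ _ _ (maxn N M)) => n.
rewrite geq_max => /andP[/hN{}hN /hM{}hM].
rewrite -(fineK (tau_fin_num x A)) -(fineK (tau_fin_num x B)) -!EFinD lee_fin.
have : (freq (A `|` B) n x <= freq A n x + freq B n x)%R.
  by rewrite -mulrDr ler_wpM2l// visitsU.
by lra.
Qed.

Lemma subset_tau x A B : A `<=` B -> tau R f x A <= tau R f x B.
Proof.
move=> AB; rewrite [leLHS]tauE; apply: lee_of_addgt0 => e e0.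
have [N hN] := tau_near_lt x B e0.
apply: (@limn_esup_le_near _ _ _ N) => n /hN{}hN.
rewrite -(fineK (tau_fin_num x B)) -EFinD lee_fin.
by apply: le_trans (ltW hN); rewrite ler_wpM2l// subset_visits.
Qed.

Lemma tau_bigsetU x (B : nat -> set T) n :
  tau R f x (\big[setU/set0]_(i < n) B i) <= \sum_(i < n) tau R f x (B i).
Proof.
elim: n => [|n IHn]; first by rewrite !big_ord0 tau_set0.
by rewrite !big_ord_recr/= (le_trans (tauU _ _ _))// leeD2r.
Qed.

(** A bounded excess of visits vanishes in the averages. *)
Let tau_le_of_visits x y A :
  (forall n, visits A n x <= visits A n y + 1)%R ->
  tau R f x A <= tau R f y A.
Proof.
move=> h; rewrite [leLHS]tauE; apply: lee_of_addgt0 => e e0.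
have e20 : (0 < e / 2)%R by rewrite divr_gt0.
have [N hN] := tau_near_lt y A e20.
pose M := Num.truncn (e / 2)^-1.
apply: (@limn_esup_le_near _ _ _ (maxn N M)) => n.
rewrite geq_max => /andP[/hN{}hN Mn].
rewrite -(fineK (tau_fin_num y A)) -EFinD lee_fin.
have : (freq A n x <= freq A n y + n.+1%:R^-1)%R.
  by rewrite -[X in (_ + X)%R]mulr1 -mulrDr ler_wpM2l.
have : (n.+1%:R^-1 < e / 2)%R.
  rewrite -(invrK (e / 2)%R) ltf_pV2 ?posrE ?invr_gt0//.
  by rewrite (lt_le_trans (truncnS_gt _))// ler_nat ltnS.
by set d := (n.+1%:R^-1)%R; lra.
Qed.

Lemma tau_shift x A : tau R f (f x) A = tau R f x A.
Proof.
apply/eqP; rewrite eq_le; apply/andP; split; apply: tau_le_of_visits => n;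
  by have := visits_shift A n x; rewrite ler_norml; lra.
Qed.

Lemma tau_iter n x A : tau R f (iter n f x) A = tau R f x A.
Proof. by elim: n => //= n <-; exact: tau_shift. Qed.

Lemma tau_preimage x A : tau R f x (f @^-1` A) = tau R f x A.
Proof.
rewrite -[RHS]tau_shift !tauE; congr limn_esup; apply/funext => n.
by rewrite /freq visits_preimage.
Qed.

Lemma iter_invariant A n x : f @^-1` A = A -> A (iter n f x) <-> A x.
Proof.
move=> fA; elim: n => // n IHn; rewrite iterS -IHn.
by rewrite -[X in _ <-> X _]fA.
Qed.

(** The orbit of a point of an invariant set never leaves that set. *)
Lemma tau_setI_invariant x A B : f @^-1` A = A -> A x ->
  tau R f x (A `&` B) = tau R f x B.
Proof.
move=> fA Ax; rewrite !tauE; congr limn_esup; apply/funext => n.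
congr (_ * _)%:E; apply: eq_bigr => i _; rewrite !indicE.
by rewrite in_setI mem_set//; apply/(iter_invariant _ _ fA).
Qed.

Lemma tau_invariant x A : f @^-1` A = A -> tau R f x A = (\1_A x)%:E.
Proof.
move=> fA; rewrite indicE; case: (boolP (x \in A)) => [/set_mem Ax|].
  by rewrite -[in LHS](setIT A) tau_setI_invariant// tau_setT.
move=> /negP; rewrite inE => nAx; apply/eqP; rewrite eq_le tau_ge0 andbT.
(* For [x] outside [A], the complement is an invariant set containing [x], and it meets [A] in the
   empty set. *)
have fC : f @^-1` (~` A) = ~` A by rewrite -preimage_setC fA.
rewrite -(@tau_setI_invariant x (~` A) A)// setICl.
by rewrite tau_set0.
Qed.

End orbit_frequency.

(** * The limsup half of Birkhoff's theorem *)

Section birkhoff.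
Context d (T : measurableType d) (R : realType).
Variable f : T -> T.
Hypothesis mf : measurable_fun setT f.

Lemma measurable_fun_iter n : measurable_fun setT (iter n f).
Proof.
elim: n => [|n IHn]; first exact: measurable_id.
exact: (measurableT_comp mf IHn).
Qed.

Lemma measurable_iter_preimage n (A : set T) :
  measurable A -> measurable (iter n f @^-1` A).
Proof.
by move=> mA; rewrite -[X in measurable X]setTI; exact: measurable_fun_iter.
Qed.

Lemma measurable_fun_visits (A : set T) n : measurable A ->
  measurable_fun setT (visits (R := R) f A n).
Proof.
move=> mA; apply: measurable_sum => j.
exact: (measurableT_comp (measurable_indic mA) (measurable_fun_iter j)).
Qed.

Lemma measurable_fun_freq (A : set T) n : measurable A ->
  measurable_fun setT (freq (R := R) f A n).
Proof.
by move=> mA; apply: measurable_funM => //; exact: measurable_fun_visits.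
Qed.

Lemma measurable_fun_tau (A : set T) : measurable A ->
  measurable_fun setT (fun x => tau R f x A).
Proof.
move=> mA; apply: measurable_fun_limn_esup => n.
by apply/measurable_EFinP; exact: measurable_fun_freq.
Qed.

Variable mu : {measure set T -> \bar R}.
Hypothesis mu_fin : mu setT < +oo.
Hypothesis mu_inv : forall A, measurable A -> mu (f @^-1` A) = mu A.

Lemma invariant_measure_iter (A : set T) n :
  measurable A -> mu (iter n f @^-1` A) = mu A.
Proof.
move=> mA; elim: n => [|n IHn]; first by [].
have -> : iter n.+1 f @^-1` A = f @^-1` (iter n f @^-1` A).
  by apply/seteqP; split => x /=; rewrite -iterSr.
by rewrite mu_inv//; exact: measurable_iter_preimage.
Qed.

Lemma integral_visits (A : set T) n : measurable A ->
  \int[mu]_x (visits f A n x)%:E = n%:R%:E * mu A.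
Proof.
move=> mA.
under eq_integral do rewrite /visits -sumEFin.
rewrite ge0_integral_sum//; last first.
  move=> j; apply/measurable_EFinP.
  exact: (measurableT_comp (measurable_indic mA) (measurable_fun_iter j)).
rewrite (eq_bigr (fun=> mu A)) => [|j _].
  by rewrite sumr_const card_ord mule_natl.
have mj := measurable_iter_preimage j mA.
rewrite -(invariant_measure_iter j mA) -[in RHS](setIT (_ @^-1` _)).
by rewrite -integral_indic.
Qed.

(** The bad points: every block of length at most [M] starting there has frequency more than [e]
    below the upper limit. *)
Let window (A : set T) (e : R) M : set T :=
  \bigcap_(n in `I_M) [set x | (freq f A n x + e)%:E < tau R f x A].

Let measurable_window A e M : measurable A -> measurable (window A e M).
Proof.
move=> mA; apply: bigcap_measurableType => n _.
rewrite -[X in measurable X]setTI; apply: measurable_lte => //.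
  apply/measurable_EFinP/measurable_funD => //; exact: measurable_fun_freq.
exact: measurable_fun_tau.
Qed.

(** The windows decrease in [M] with empty intersection, since some term of a sequence comes within
    [e] of its upper limit. *)
Let window_cvg0 A (e : R) : measurable A -> (0 < e)%R ->
  mu (window A e M) @[M --> \oo] --> 0.
Proof.
move=> mA e0; have mW M := measurable_window e M mA.
rewrite -(measure0 mu) -[X in _ --> mu X](_ : \bigcap_M window A e M = _).
  apply: nonincreasing_cvg_mu => //.
  - by rewrite (le_lt_trans _ mu_fin)// le_measure ?inE.
  - exact: bigcapT_measurable.
  - move=> m n mn; apply/subsetPset => x h k /= km; apply: h => /=.
    exact: leq_trans mn.
rewrite -subset0 => x h.
have : tau R f x A - e%:E < tau R f x A.
  by rewrite gte_subl ?tau_fin_num// lte_fin.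
move=> /(@limn_esup_gt _ _ _)/(_ 0%N)[n _]; rewrite -/(freq f A n x).
rewrite lteBlDr// -EFinD ltNge => /negP; apply.
exact: (ltW (h n.+1 I n (ltnSn _))).
Qed.

(* The orbit is cut greedily into blocks of length at most M along which the
   frequency of visits is almost maximal; only the last block may fail. *)
Let visits_ge A (e : R) M L x : (0 < e)%R ->
  (L%:R * (fine (tau R f x A) - e) <= visits f (A `|` window A e M) L x + M%:R)%R.
Proof.
move=> e0; have [n] := ubnP L; elim: n L x => // n IHn L x Ln.
have g1 y : (fine (tau R f y A) <= 1)%R.
  by rewrite -lee_fin fineK ?tau_fin_num ?tau_le1.
(* A segment of length at most [M] is paid for by the summand [M], because [tau] is at most 1. *)
have [LM|ML] := leqP L M.
  have := visits_ge0 (R := R) f (A `|` window A e M) L x.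
  have : (L%:R * (fine (tau R f x A) - e) <= M%:R)%R.
    apply: (@le_trans _ _ L%:R); last by rewrite ler_nat.
    by rewrite ler_piMr//; have := g1 x; lra.
  by lra.
have [k /andP[k0 kL] hk] : exists2 k, (0 < k <= L)%N &
    (k%:R * (fine (tau R f x A) - e) <= visits f (A `|` window A e M) k x)%R.
  (* A bad point is a block of length one; it counts as a visit because the window has been added to
     [A]. *)
  have [Wx|] := pselect (window A e M x).
    exists 1%N; first by rewrite (leq_ltn_trans _ ML).
    rewrite /visits big_ord1 mul1r indicE mem_set/=; last by right.
    by have := g1 x; lra.
  move=> /existsNP[k /not_implyP[/= kM]] /negP; rewrite -leNgt => h.
  exists k.+1; first by rewrite (leq_trans _ ML)// ltnW.
  apply: (@le_trans _ _ (visits f A k.+1 x)); last exact/subset_visits/subsetUl.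
  move: h; rewrite -(fineK (tau_fin_num f x A)) lee_fin -lerBlDr mulrC.
  by rewrite /freq [X in (_ <= X)%R -> _]mulrC ler_pdivlMr.
(* The block is split off; [tau] is constant along the orbit, so the induction hypothesis for the
   rest has the same target frequency. *)
rewrite -(subnKC kL) visitsD natrD mulrDl.
have := IHn (L - k)%N (iter k f x); rewrite tau_iter => /(_ _).
have -> : (L - k < n)%N.
  by rewrite (@leq_trans L)// ltn_subrL k0 (leq_trans k0 kL).
by move=> /(_ isT); move: hk; set a := (_ * _)%R; set b := (_ * _)%R; lra.
Qed.

(* The limsup half of Birkhoff's theorem; applied to both A and its complement
   it already forces the visit frequencies to converge. *)
Lemma integral_tau_le (A : set T) : measurable A ->
  \int[mu]_x tau R f x A <= mu A.
Proof.
move=> mA.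
have muE B : measurable B -> mu B \is a fin_num.
  move=> mB; rewrite ge0_fin_numE// (le_lt_trans _ mu_fin)//.
  by rewrite le_measure ?inE.
have mtau := measurable_fun_tau mA.
have I0 : 0 <= \int[mu]_x tau R f x A.
  by apply: integral_ge0 => x _; exact: tau_ge0.
have Ifin : \int[mu]_x tau R f x A \is a fin_num.
  rewrite ge0_fin_numE// (le_lt_trans _ mu_fin)//.
  rewrite -[leRHS]mul1e -integral_cst//; apply: ge0_le_integral => //.
    by move=> x _; exact: tau_ge0.
  by move=> x _; exact: tau_le1.
set m := fine (mu setT); set I := fine (\int[mu]_x tau R f x A).
have m0 : (0 <= m)%R by rewrite fine_ge0.
(* This is [visits_ge] integrated; invariance turns the integrated visit count into [L] times a
   measure. *)
have key (e : R) M L : (0 < e)%R -> (L%:R * I <=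
    L%:R * fine (mu (A `|` window A e M)) + (M%:R + L%:R * e) * m)%R.
  move=> e0; have mW := measurable_window e M mA.
  have mAW : measurable (A `|` window A e M) by exact: measurableU.
  rewrite -lee_fin EFinD !EFinM !fineK ?muE// -(integral_visits _ mAW).
  rewrite -ge0_integralZl_EFin//; last by move=> x _; exact: tau_ge0.
  rewrite -integral_cst// -ge0_integralD//; first last.
  - by move=> x _; rewrite lee_fin addr_ge0// mulr_ge0// ltW.
  - by apply/measurable_EFinP; exact: measurable_fun_visits.
  - by move=> x _; rewrite lee_fin visits_ge0.
  apply: ge0_le_integral => //.
  - by move=> x _; rewrite mule_ge0 ?lee_fin ?tau_ge0.
  - exact: measurable_funeM.
  - apply: emeasurable_funD => //.
    by apply/measurable_EFinP; exact: measurable_fun_visits.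
  move=> x _; rewrite -(fineK (tau_fin_num f x A)) /= -EFinM -EFinD lee_fin.
  by have := visits_ge A M L x e0; rewrite mulrBr; lra.
have key2 (e : R) M : (0 < e)%R ->
    (I <= fine (mu A) + fine (mu (window A e M)) + e * m)%R.
  move=> e0; have mW := measurable_window e M mA.
  rewrite leNgt; apply/negP; rewrite -subr_gt0; set b := (_ - _)%R => b0.
  (* The length [L] is so large that the error [M * m] of the last block is below [L] times the
     supposed gap [b]. *)
  have := key e M (Num.truncn (M%:R * m / b)).+1 e0.
  set L := _.+1.
  have Lb : (M%:R * m < L%:R * b)%R.
    by rewrite -ltr_pdivrMr// truncnS_gt.
  have : (L%:R * fine (mu (A `|` window A e M)) <=
          L%:R * (fine (mu A) + fine (mu (window A e M))))%R.
    rewrite ler_wpM2l// -fineD ?muE//; apply: fine_le; rewrite ?muE//.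
      exact: measurableU.
      by rewrite fin_numD !muE.
    exact: measureU2.
  rewrite leNgt => h1 h2; move: h1; apply/negP.
  by move: Lb h2; rewrite /b; nra.
rewrite -(fineK Ifin) -(fineK (muE _ mA)) -/I; apply: lee_of_addgt0 => e e0.
rewrite -EFinD lee_fin.
(* The window, of mass below [e'], and the term [e' * m] then cost at most [e] together. *)
pose e' := (e / (1 + m))%R.
have e'0 : (0 < e')%R by rewrite divr_gt0// ltr_pwDl.
have : exists M, (fine (mu (window A e' M)) < e')%R.
  have /fine_cvgP[_ /cvgrPdist_lt/(_ _ e'0)[M _ /(_ M (leqnn _))]] :=
    window_cvg0 mA e'0.
  by rewrite /= sub0r normrN ger0_norm ?fine_ge0// => ?; exists M.
move=> [M hM]; apply: le_trans (key2 e' M e'0) _.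
have -> : e = (e' * (1 + m))%R by rewrite /e' divfK// gt_eqF// ltr_pwDl.
by rewrite mulrDr mulr1; lra.
Qed.

End birkhoff.

(** * Carathéodory's criterion for metric outer measures *)

Section metric_outer_measure.
Context {R : realType} {T : pointedType} (dist : T -> T -> R).
Hypothesis hmet : is_metric dist.

Definition separated_by (e : R) (A B : set T) :=
  forall a b, A a -> B b -> (e <= dist a b)%R.

Variable m : {outer_measure set T -> \bar R}.
Hypothesis m_metric : forall (e : R) A B, (0 < e)%R -> separated_by e A B ->
  m A + m B <= m (A `|` B).

(** The usual exhaustion of an open set by sets at positive distance from its complement. *)
Definition inner_part (U : set T) n : set T :=
  [set x | forall y, ~ U y -> (n.+1%:R^-1 <= dist x y)%R].

Lemma bigcup_inner_part U : metric_open dist U -> \bigcup_n inner_part U n = U.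
Proof.
have [d0 deq dsym _] := hmet.
move=> oU; apply/seteqP; split=> [x [n _ Vx]|x /oU[e [e0 Ue]]].
  apply: contrapT => /Vx; have -> : dist x x = 0%R by exact/deq.
  by apply/negP; rewrite -ltNge invr_gt0.
exists (Num.truncn e^-1) => // y nUy; rewrite leNgt; apply/negP => h.
apply: nUy; apply: Ue; apply: lt_trans h _.
by rewrite -[ltRHS]invrK ltf_pV2 ?posrE ?invr_gt0// truncnS_gt.
Qed.

Lemma inner_part_mono U k n : (k <= n)%N -> inner_part U k `<=` inner_part U n.
Proof.
move=> kn x Vx y /Vx; apply: le_trans.
by rewrite lef_pV2 ?posrE// ler_nat.
Qed.

(** A point outside the larger inner part is within [1/(n+2)] of the complement of [U], from which
    the smaller one keeps distance [1/(n+1)]. *)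
Lemma inner_part_separated U n :
  separated_by (n.+1%:R^-1 - n.+2%:R^-1) (inner_part U n) (~` inner_part U n.+1).
Proof.
have [d0 deq dsym dtri] := hmet.
move=> a b Va /existsNP[z /not_implyP[Uz /negP]]; rewrite -ltNge => bz.
move: bz (Va _ Uz) (dtri a b z).
by set p := (n.+1%:R^-1)%R; set q := (n.+2%:R^-1)%R; lra.
Qed.

(** The layers [D k] of [X] between consecutive inner parts have summable mass. Up to a vanishing
    tail, [U] can therefore be replaced by an inner part, which is separated from the complement of
    [U]. *)
Lemma caratheodory_measurable_open U : metric_open dist U -> m.-caratheodory U.
Proof.
move=> oU; apply: le_caratheodory_measurable => X.
have [->|Xoo] := eqVneq (m X) +oo; first exact: leey.
have leX Y : Y `<=` X -> m Y \is a fin_num.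
  move=> YX; rewrite ge0_fin_numE ?outer_measure_ge0//.
  by rewrite (le_lt_trans (le_outer_measure m _ _ YX))// ltey.
pose a n := m (X `&` inner_part U n).
pose D n := X `&` (inner_part U n.+1 `\` inner_part U n).
have aX n : a n <= m X by apply: le_outer_measure => x [].
have DX n : m (D n) \is a fin_num by apply: leX => x [].
have step n : a n + m (D n.+1) <= a n.+2.
  apply: (@le_trans _ _ (m ((X `&` inner_part U n) `|` D n.+1))).
    apply: (@m_metric (n.+1%:R^-1 - n.+2%:R^-1)%R).
      by rewrite subr_gt0 ltf_pV2 ?posrE// ltr_nat.
    by move=> x y [_ Vx] [_ [_ Vy]]; exact: (inner_part_separated Vx Vy).
  apply: le_outer_measure => x [[Xx Vx]|[Xx []]//]; split => //.
  exact: (inner_part_mono (leqW (leqnSn n)) Vx).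
(* By [step], layers of even index and layers of odd index form two chains, one for each summand on
   the right. *)
have sumD N : \sum_(1 <= k < N.+1) m (D k) <= a N + a N.+1.
  elim: N => [|N IHN]; first by rewrite big_geq// adde_ge0 ?outer_measure_ge0.
  rewrite big_nat_recr//= (le_trans (leeD2r _ IHN))// -addeA addeC -addeA.
  by apply: leeD2l; rewrite addeC; exact: step.
have tail : \sum_(n <= k <oo) m (D k) @[n --> \oo] --> 0.
  apply: nneseries_tail_cvg => [|k _]; last exact: outer_measure_ge0.
  rewrite nneseries_recl//.
  rewrite lte_add_pinfty//; first by rewrite -ge0_fin_numE ?outer_measure_ge0.
  apply: (@le_lt_trans _ _ (m X + m X)); last by rewrite lte_add_pinfty// ltey.
  apply: lime_le; first by apply: is_cvg_nneseries => *; exact: outer_measure_ge0.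
  apply: nearW => -[|N]; first by rewrite big_geq// adde_ge0 ?outer_measure_ge0.
  by apply: le_trans (sumD N) _; exact: leeD.
have le_tail n : m (X `&` U) + m (X `&` ~` U) <=
    m X + \sum_(n <= k <oo) m (D k).
  apply: (@le_trans _ _ ((a n + \sum_(n <= k <oo) m (D k)) + m (X `&` ~` U))).
    apply: leeD2r.
    apply: (@le_trans _ _ (m ((X `&` inner_part U n) `|` \bigcup_(k in ~` `I_n) D k))).
      apply: le_outer_measure => x [Xx]; rewrite -{1}(bigcup_inner_part oU) => Ux.
      have := Ux => -[k _].
      (* Descending to the first inner part that contains [x] puts [x] into the [n]-th one or into a
         layer of index at least [n]. *)
      elim: k => [|k IHk] Vx.
        by left; split=> //; exact: inner_part_mono Vx.
      have [|nVx] := pselect (inner_part U k x); first exact: IHk.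
      have [kn|nk] := ltnP k n.
        by left; split=> //; exact: inner_part_mono Vx.
      by right; exists k => //=; apply/negP; rewrite -leqNgt.
    rewrite (le_trans (outer_measureU2 _ _ _))// leeD2l//.
    exact: outer_measure_sigma_subadditive_tail.
  rewrite addeAC leeD2r//.
  apply: (@le_trans _ _ (m ((X `&` inner_part U n) `|` (X `&` ~` U)))).
    apply: (@m_metric n.+1%:R^-1%R); first by rewrite invr_gt0.
    by move=> x y [_ Vx] [_ nUy]; exact: Vx.
  by apply: le_outer_measure => x [[]|[]].
have : m X + \sum_(n <= k <oo) m (D k) @[n --> \oo] --> m X + 0.
  by apply: cvgeD => //; [rewrite fin_num_adde_defl// leX|exact: cvg_cst].
rewrite adde0 => cX; rewrite -(cvg_lim _ cX)//; apply: lime_ge.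
  by apply/cvg_ex; exists (m X).
exact: nearW.
Qed.

Lemma caratheodory_measurable_borel (A : set (borel dist)) :
  measurable A -> m.-caratheodory A.
Proof.
apply: smallest_sub; last exact: caratheodory_measurable_open.
exact: (@sigma_algebra_measurable _ (caratheodory_type m)).
Qed.

End metric_outer_measure.

(** * The outer measure [nu] and its additivity on separated sets *)

Section nu_outer_measure.
Context {R : realType} {T : pointedType} (dist : T -> T -> R) (f : T -> T).
Implicit Types (x : T) (r : R) (Y : set T).

(* nu_r is the outer measure generated by the premeasure equal to tau on small
   open sets and to +oo on all others, on the discrete sigma-algebra. *)
Let small_premeasure x r (A : set (g_sigma_algebraType [set: set T])) : \bar R :=
  if `[< metric_open dist A /\ diam_le dist A r >] then tau R f x A else +oo.

Let small_premeasure_ge0 x r A : 0 <= small_premeasure x r A.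
Proof. by rewrite /small_premeasure; case: ifPn => // _; exact: tau_ge0. Qed.

Let small_premeasure0 x r : small_premeasure x r set0 = 0.
Proof.
by rewrite /small_premeasure ifT ?tau_set0//; apply/asboolP; split.
Qed.

(** A cover with a member that is not small and open costs [+oo], so it does not affect the infimum;
    [nu_r] thus inherits the properties of [mu_ext]. *)
Let nu_rE x r : nu_r dist f x r = mu_ext (small_premeasure x r).
Proof.
apply/funext => Y; apply/eqP; rewrite eq_le; apply/andP; split.
- apply: le_ereal_inf_tmp => _ [I [_ YI] <-].
  have [smallI|/existsNP[n nI]] :=
      pselect (forall n, metric_open dist (I n) /\ diam_le dist (I n) r).
    apply: ereal_inf_lbound; exists I => //.
    by apply: eq_eseriesr => n _; rewrite /small_premeasure ifT//; exact/asboolP.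
  suff -> : \sum_(k <oo) small_premeasure x r (I k) = +oo by rewrite leey.
  apply: (@eseries_pinfty _ _ xpredT n) => // [k _|].
    by rewrite -ltNye (lt_le_trans _ (small_premeasure_ge0 _ _ _)).
  by rewrite /small_premeasure ifF//; exact/asboolP.
- apply: le_ereal_inf_tmp => _ [I [smallI YI] <-].
  apply: ereal_inf_lbound; exists I.
    by split=> // n; exact: sub_sigma_algebra.
  by apply: eq_eseriesr => n _; rewrite /small_premeasure ifT//; exact/asboolP.
Qed.

Lemma nu_r_ge0 x r Y : 0 <= nu_r dist f x r Y.
Proof. by rewrite nu_rE; exact: mu_ext_ge0. Qed.

Lemma nu_r0 x r : nu_r dist f x r set0 = 0.
Proof. by rewrite nu_rE; exact: mu_ext0. Qed.

Lemma le_nu_r x r : {homo nu_r dist f x r : A B / A `<=` B >-> A <= B}.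
Proof.
by move=> A B AB; rewrite nu_rE; exact: (le_mu_ext (small_premeasure x r) AB).
Qed.

Lemma nu_r_sigma_subadditive x r : sigma_subadditive (nu_r dist f x r).
Proof.
rewrite nu_rE => F.
exact: (mu_ext_sigma_subadditive (small_premeasure_ge0 x r) F).
Qed.

Lemma nu_r_antitone x r s Y : (r <= s)%R ->
  nu_r dist f x s Y <= nu_r dist f x r Y.
Proof.
move=> rs; apply: ereal_inf_le_tmp => _ [I [smallI YI] <-]; exists I => //.
split=> // n; have [oI dI] := smallI n; split=> // a b Ia Ib.
exact: le_trans (dI _ _ Ia Ib) rs.
Qed.

Lemma nu_r_le_nu x r Y : (0 < r)%R -> nu_r dist f x r Y <= nu dist f x Y.
Proof. by move=> r0; apply: ereal_sup_ubound; exists r. Qed.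

Lemma nu_ge0 x Y : 0 <= nu dist f x Y.
Proof. exact: le_trans (nu_r_ge0 _ _ _) (nu_r_le_nu _ _ ltr01). Qed.

Lemma nu0 x : nu dist f x set0 = 0.
Proof.
apply/eqP; rewrite eq_le nu_ge0 andbT.
by apply: ge_ereal_sup => _ [r _ <-]; rewrite nu_r0.
Qed.

Lemma le_nu x : {homo nu dist f x : A B / A `<=` B >-> A <= B}.
Proof.
move=> A B AB; apply: ge_ereal_sup => _ [r r0 <-].
exact: le_trans (le_nu_r _ _ AB) (nu_r_le_nu _ _ r0).
Qed.

Lemma nu_sigma_subadditive x : sigma_subadditive (nu dist f x).
Proof.
move=> F; apply: ge_ereal_sup => _ [r r0 <-].
apply: le_trans (nu_r_sigma_subadditive _ _ _) _.
by apply: lee_nneseries => n _ *; [exact: nu_r_ge0|exact: nu_r_le_nu].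
Qed.

HB.instance Definition _ x := isOuterMeasure.Build R T (nu dist f x)
  (nu0 x) (nu_ge0 x) (@le_nu x) (@nu_sigma_subadditive x).

(** A set of diameter at most [r < e] cannot meet both [A] and [B], so a cover of the union splits
    into a cover of each; omitted members become [set0], of frequency 0. *)
Lemma nu_r_metric x r e (A B : set T) : (r < e)%R -> separated_by dist e A B ->
  nu_r dist f x r A + nu_r dist f x r B <= nu_r dist f x r (A `|` B).
Proof.
move=> re sepAB; apply: le_ereal_inf_tmp => _ [I [smallI ABI] <-].
pose meets := fun n => `[< A `&` I n !=set0 >].
pose J n := if meets n then I n else set0.
pose K n := if meets n then set0 else I n.
have small0 : metric_open dist set0 /\ diam_le dist set0 r by split.
have tau0 (L : nat -> set T) n : 0 <= tau R f x (L n) by apply: tau_ge0.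
have -> : \sum_(n <oo) tau R f x (I n) =
    \sum_(n <oo) tau R f x (J n) + \sum_(n <oo) tau R f x (K n).
  rewrite -nneseriesD//; apply: eq_eseriesr => n _; rewrite /J /K.
  by case: ifP; rewrite tau_set0 ?adde0 ?add0e.
apply: leeD; apply: ereal_inf_lbound.
  exists J => //; split=> [n|a Aa]; first by rewrite /J; case: ifP.
  have [n _ Ia] := ABI _ (or_introl Aa); exists n => //.
  by rewrite /J ifT//; apply/asboolP; exists a.
exists K => //; split=> [n|b Bb]; first by rewrite /K; case: ifP.
have [n _ Ib] := ABI _ (or_intror Bb); exists n => //.
rewrite /K ifF//; apply/negbTE/asboolP => -[a [Aa Ia]].
have := sepAB _ _ Aa Bb; rewrite leNgt => /negP; apply.
by apply: le_lt_trans re; apply: (smallI n).2.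
Qed.

Lemma nu_metric x e (A B : set T) : (0 < e)%R -> separated_by dist e A B ->
  nu dist f x A + nu dist f x B <= nu dist f x (A `|` B).
Proof.
move=> e0 sepAB; set C := nu dist f x (A `|` B).
have [->|Coo] := eqVneq C +oo; first exact: leey.
have Cfin Y : Y `<=` A `|` B -> nu dist f x Y \is a fin_num.
  move=> YAB; rewrite ge0_fin_numE ?nu_ge0//.
  by apply: (@le_lt_trans _ _ C); [exact: le_nu|rewrite ltey].
have Afin := Cfin A (@subsetUl _ _ _); have Bfin := Cfin B (@subsetUr _ _ _).
rewrite -leeBrDr//; apply: ge_ereal_sup => _ [r /= r0 <-].
rewrite leeBrDr// addeC -leeBrDr; last first.
  rewrite ge0_fin_numE ?nu_r_ge0// (le_lt_trans (nu_r_le_nu _ _ r0))//.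
  by rewrite -ge0_fin_numE ?nu_ge0.
apply: ge_ereal_sup => _ [s /= s0 <-].
rewrite leeBrDr; last first.
  rewrite ge0_fin_numE ?nu_r_ge0// (le_lt_trans (nu_r_le_nu _ _ r0))//.
  by rewrite -ge0_fin_numE ?nu_ge0.
(* As [nu_r] grows when [r] shrinks, one scale below [r], [s] and [e] serves both suprema. *)
pose t := Num.min (Num.min r s) (e / 2)%R.
have t0 : (0 < t)%R by rewrite !lt_min r0 s0 divr_gt0.
have te : (t < e)%R.
  by rewrite gt_min ltr_pdivrMr// ltr_pMr// ltr1n orbT.
apply: (@le_trans _ _ (nu_r dist f x t A + nu_r dist f x t B)).
  by rewrite addeC; apply: leeD; apply: nu_r_antitone; rewrite !ge_min lexx ?orbT.
exact: le_trans (nu_r_metric _ te sepAB) (nu_r_le_nu _ _ t0).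
Qed.

End nu_outer_measure.

(** * The restriction of [nu] to the Borel sets as a measure *)

Section borel_nu_measure.
Context {R : realType} {T : pointedType} (dist : T -> T -> R).

(** The metric axioms are an argument so that the measure instance, whose additivity rests on them,
    can be attached to this name. *)
Definition nu_measure of is_metric dist :=
  fun (f : T -> T) (x : T) (A : set (borel dist)) => nu dist f x A.

Variables (hmet : is_metric dist) (f : T -> T) (x : T).

Let nu_measure0 : nu_measure hmet f x set0 = 0. Proof. exact: nu0. Qed.

Let nu_measure_ge0 A : 0 <= nu_measure hmet f x A. Proof. exact: nu_ge0. Qed.

Let nu_measure_semi_sigma_additive : semi_sigma_additive (nu_measure hmet f x).
Proof.
move=> F mF tF mUF.
have cara A : (measurable : set (set (borel dist))) A ->
    (nu dist f x).-caratheodory A.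
  by apply: caratheodory_measurable_borel => // e A' B'; exact: nu_metric.
by apply: (@caratheodory_measure_sigma_additive _ _ (nu dist f x)) => // *;
  exact: cara.
Qed.

HB.instance Definition _ := isMeasure.Build _ (borel dist) R (nu_measure hmet f x)
  nu_measure0 nu_measure_ge0 nu_measure_semi_sigma_additive.

End borel_nu_measure.

(** * Compactness and the total mass of [nu] *)

Section nu_compact.
Context {R : realType} {T : pointedType} (dist : T -> T -> R) (f : T -> T).
Hypothesis hcpt : metric_compact dist.

Lemma metric_compact_nat (I : nat -> set T) :
  (forall n, metric_open dist (I n)) -> \bigcup_n I n = setT ->
  exists N, \big[setU/set0]_(n < N) I n = setT.
Proof.
move=> oI IT; have [|x|F [finF FI Fcov]] := hcpt (C := range I).
- by move=> _ [n _ <-].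
- have [n _ Inx] : (\bigcup_n I n) x by rewrite IT.
  by exists (I n); split => //; exists n.
have /choice[g gP] : forall U, exists n, F U -> I n = U.
  move=> U; have [/FI[n _ <-]|nFU] := pselect (F U); first by exists n.
  by exists 0%N.
have /finite_seqP[s sE] : finite_set (g @` F) by exact: finite_image.
exists (\max_(i <- s) i).+1; rewrite -subTset => x _.
have [U [FU Ux]] := Fcov x; rewrite -bigcup_mkord; exists (g U); last by rewrite gP.
rewrite /= ltnS; apply: (leq_bigmax_seq (F := id)) => //.
by have : (g @` F) (g U) by [exists U]; rewrite sE.
Qed.

(** By subadditivity of [tau], a finite subcover already has total frequency at least that of the
    whole space, which is 1. *)
Lemma nu_setT_ge1 x : 1 <= nu dist f x setT.
Proof.
apply: le_trans (nu_r_le_nu _ _ _ _ ltr01).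
apply: le_ereal_inf_tmp => _ [I [smallI TI] <-].
have IT : \bigcup_n I n = setT by apply/seteqP.
have [N IN] := metric_compact_nat (fun n => (smallI n).1) IT.
rewrite -(tau_setT (R := R) f x) -IN (le_trans (tau_bigsetU _ _ _ _))//.
rewrite -(big_mkord xpredT (fun i => tau R f x (I i))).
by apply: nneseries_lim_ge => n _ _; exact: tau_ge0.
Qed.

End nu_compact.

(** * Outer regularity of finite Borel measures *)

Lemma measure_bigcap_lt d (T : measurableType d) (R : realType)
    (mu : {measure set T -> \bar R}) (E : nat -> set T) c :
  mu setT < +oo -> (forall n, measurable (E n)) ->
  (forall m n, (m <= n)%N -> E n `<=` E m) -> mu (\bigcap_n E n) < c ->
  exists n, mu (E n) < c.
Proof.
move=> mufin mE dE Ec; apply: contrapT => /forallNP h.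
move: Ec; apply/negP; rewrite -leNgt.
have cE : mu (E n) @[n --> \oo] --> mu (\bigcap_n E n).
  apply: nonincreasing_cvg_mu => //.
  - by rewrite (le_lt_trans _ mufin)// le_measure ?inE.
  - exact: bigcapT_measurable.
  - by move=> m n mn; exact/subsetPset/dE.
rewrite -(cvg_lim _ cE)//; apply: lime_ge.
  by apply/cvg_ex; exists (mu (\bigcap_n E n)).
by apply: nearW => n; rewrite leNgt; apply/negP/h.
Qed.

Section outer_regularity.
Context {R : realType} {T : pointedType} (dist : T -> T -> R).
Hypothesis hmet : is_metric dist.

Lemma metric_openT : metric_open dist setT.
Proof. by move=> x _; exists 1%R; split. Qed.

Lemma metric_openI A B :
  metric_open dist A -> metric_open dist B -> metric_open dist (A `&` B).
Proof.
move=> oA oB x [/oA[a [a0 hA]] /oB[b [b0 hB]]].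
exists (Num.min a b); split=> [|y]; first by rewrite lt_min a0 b0.
by rewrite lt_min => /andP[/hA ? /hB].
Qed.

Lemma metric_open_bigcup (I : Type) (D : set I) (F : I -> set T) :
  (forall i, D i -> metric_open dist (F i)) ->
  metric_open dist (\bigcup_(i in D) F i).
Proof.
move=> oF x [i Di /(oF i Di)[e [e0 h]]]; exists e; split=> // y /h Fy.
by exists i.
Qed.

Lemma metric_open_bigsetI n (F : nat -> set T) :
  (forall i, metric_open dist (F i)) ->
  metric_open dist (\big[setI/setT]_(i < n) F i).
Proof.
move=> oF; elim: n => [|n IHn]; first by rewrite big_ord0; exact: metric_openT.
by rewrite big_ord_recr/=; exact: metric_openI.
Qed.

Lemma measurable_open (U : set (borel dist)) : metric_open dist U -> measurable U.
Proof. exact: sub_sigma_algebra. Qed.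

Lemma metric_open_setC_inner_part U n : metric_open dist (~` inner_part dist U n).
Proof.
have [d0 deq dsym dtri] := hmet.
move=> x /existsNP[z /not_implyP[Uz /negP]]; rewrite -ltNge.
set p := (n.+1%:R^-1)%R => xz.
exists (p - dist x z)%R; split=> [|y xy /(_ _ Uz)]; first by rewrite subr_gt0.
rewrite -/p; have := dtri y x z; rewrite (dsym y x); lra.
Qed.

Variable mu : {measure set (borel dist) -> \bar R}.
Hypothesis mu_fin : mu setT < +oo.

(** Approximation from both sides, by closed and by open sets: this symmetric form passes to
    complements. *)
Let regular : set (set T) := [set A | forall e : R, (0 < e)%R ->
  exists F U, [/\ metric_open dist (~` F), metric_open dist U,
    F `<=` A, A `<=` U & mu (U `\` F) < e%:E]].

Let measurable_closed F : metric_open dist (~` F) ->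
  measurable (F : set (borel dist)).
Proof. by move=> /measurable_open/measurableC; rewrite setCK. Qed.

Let regular_open U : metric_open dist U -> regular U.
Proof.
move=> oU e e0; have mU := measurable_open oU.
have mF n : measurable (inner_part dist U n : set (borel dist)).
  by apply: measurable_closed; exact: metric_open_setC_inner_part.
have [||||n hn] := @measure_bigcap_lt _ _ _ mu
    (fun n => U `\` inner_part dist U n) e%:E.
- exact: mu_fin.
- by move=> n; exact: measurableD.
- by move=> m n mn x [Ux nVx]; split=> // Vx; apply: nVx; exact: inner_part_mono Vx.
- rewrite [X in mu X](_ : _ = set0) ?measure0 ?lte_fin// -subset0 => x h.
  have [Ux _] := h 0%N I; move: Ux; rewrite -(bigcup_inner_part hmet oU).
  by move=> [n _ Vx]; have [] := h n I.
exists (inner_part dist U n), U; split=> //.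
  exact: metric_open_setC_inner_part.
by rewrite -[X in _ `<=` X](bigcup_inner_part hmet oU) => x Vx; exists n.
Qed.

Let regular_setC A : regular A -> regular (~` A).
Proof.
move=> rA e /rA[F [U [oF oU FA AU h]]]; exists (~` U), (~` F); split=> //.
- by rewrite setCK.
- exact: subsetC.
- exact: subsetC.
- by rewrite setDE setCK setIC -setDE.
Qed.

Let regular_bigcup (A : nat -> set T) :
  (forall n, regular (A n)) -> regular (\bigcup_n A n).
Proof.
(* The errors add up to [e / 2], which keeps the final inequality strict. *)
move=> rA e e0; pose d n := (e / 2 / (2 ^ n.+1)%:R)%R.
have d0 n : (0 < d n)%R by rewrite !divr_gt0.
have /choice[FU FUP] : forall n, exists FU : set T * set T,
    [/\ metric_open dist (~` FU.1), metric_open dist FU.2,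
    FU.1 `<=` A n, A n `<=` FU.2 & mu (FU.2 `\` FU.1) < (d n)%:E].
  by move=> n; have [F [U h]] := rA n _ (d0 n); exists (F, U).
pose F n := (FU n).1; pose U n := (FU n).2.
have oF n : metric_open dist (~` F n) by have [] := FUP n.
have oU n : metric_open dist (U n) by have [] := FUP n.
have mF n : measurable (F n : set (borel dist)) by exact: measurable_closed.
have mU n : measurable (U n : set (borel dist)) by exact: measurable_open.
(* An infinite union of closed sets may fail to be closed; a finite union [G N] is closed, and for
   large [N] continuity from above makes the loss small. *)
pose V := \bigcup_n U n; pose G N := \big[setU/set0]_(i < N) F i.
have oV : metric_open dist V by apply: metric_open_bigcup => n _; exact: oU.
have mV := measurable_open oV.
have oG N : metric_open dist (~` G N).
  by rewrite setC_bigsetU; exact: (@metric_open_bigsetI N (fun i => ~` F i)).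
have mG N := measurable_closed (oG N).
have GS N : G N `<=` \bigcup_n F n by exact: bigsetU_bigcup.
have VF : mu (V `\` \bigcup_n F n) < e%:E.
  apply: (@le_lt_trans _ _ (\sum_(n <oo) mu (U n `\` F n))).
    apply: measure_sigma_subadditive.
    - by move=> n; exact: measurableD.
    - by apply: measurableD => //; exact: bigcupT_measurable.
    - move=> x [[n _ Ux] nFx]; exists n => //; split=> // Fx.
      by apply: nFx; exists n.
  apply: (@le_lt_trans _ _ (\sum_(n <oo) (0 + (d n)%:E))).
    apply: lee_nneseries => [n _ _|n _]; first exact: measure_ge0.
    by rewrite add0e; have [_ _ _ _ /ltW] := FUP n.
  have e20 : (0 <= e / 2)%R by rewrite divr_ge0// ltW.
  have := @epsilon_trick _ (fun=> 0) (e / 2)%R xpredT (fun=> lexx 0) e20.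
  move=> /le_lt_trans; apply.
  by rewrite eseries0// add0e lte_fin ltr_pdivrMr// ltr_pMr// ltr1n.
have [||||N hN] := @measure_bigcap_lt _ _ _ mu (fun N => V `\` G N) e%:E.
- exact: mu_fin.
- by move=> n; exact: measurableD.
- move=> m n mn x [Vx nGx]; split=> // Gx; apply: nGx; move: Gx.
  exact: subset_bigsetU.
- rewrite [X in mu X](_ : _ = V `\` \bigcup_n F n)//.
  apply/seteqP; split=> [x h|x [Vx nFx] n _]; last first.
    by split=> // Gx; apply: nFx; exact: GS Gx.
  have [Vx _] := h 0%N I; split=> // -[n _ Fx]; have [_] := h n.+1 I; apply.
  by rewrite /G big_ord_recr/=; right.
exists (G N), V; split=> //.
  apply: subset_trans (GS N) _ => x [n _ Fx]; exists n => //.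
  by have [_ _ + _ _] := FUP n; exact.
by move=> x [n _ Ax]; exists n => //; have [_ _ _ + _] := FUP n; exact.
Qed.

Lemma outer_regular (A : set (borel dist)) (e : R) : measurable A -> (0 < e)%R ->
  exists U, [/\ metric_open dist U, A `<=` U & mu U <= mu A + e%:E].
Proof.
move=> mA; have : regular A.
  move: A mA; apply: smallest_sub; last exact: regular_open.
  split; last exact: regular_bigcup.
    by apply: regular_open.
  by move=> A; rewrite setTD; exact: regular_setC.
move=> /[apply] -[F [U [oF oU FA AU h]]]; exists U; split=> //.
have mF := measurable_closed oF; have mU := measurable_open oU.
rewrite -(setDUK AU) measureU//; last first.
- by rewrite setDIK.
- exact: measurableD.
rewrite leeD2l// (le_trans _ (ltW h))// le_measure ?inE//; try exact: measurableD.
by move=> x [Ux nAx]; split=> // /FA.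
Qed.

End outer_regularity.

(** * Finite covers by small open sets *)

Section small_covers.
Context {R : realType} {T : pointedType} (dist : T -> T -> R).
Hypothesis hmet : is_metric dist.
Hypothesis hcpt : metric_compact dist.

Definition small_open (r : R) (U : set T) :=
  metric_open dist U /\ diam_le dist U r.

Lemma small_open_ball r x : (0 < r)%R ->
  small_open r [set y | (dist x y < r / 2)%R].
Proof.
have [d0 deq dsym dtri] := hmet.
move=> r0; split=> [y /= xy|y z /= xy xz].
  exists (r / 2 - dist x y)%R; split=> [|z yz /=]; first by rewrite subr_gt0.
  by have := dtri x y z; lra.
by have := dtri y x z; rewrite (dsym y x); lra.
Qed.

Lemma finite_small_cover r : (0 < r)%R ->
  exists N (B : nat -> set T), (forall n, small_open r (B n)) /\
    \big[setU/set0]_(n < N) B n = setT.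
Proof.
have [_ deq _ _] := hmet.
move=> r0; have [||F [finF FC Fcov]] := hcpt (C := small_open r).
- by move=> U [].
- move=> x; exists [set y | (dist x y < r / 2)%R]; split.
    exact: small_open_ball.
  by rewrite /= (deq x x).2// divr_gt0.
have /finite_seqP[s sE] := finF.
(* Past the end of the list the default [set0] is open and of diameter at most [r], so every [B n]
   is small. *)
exists (size s), (nth set0 s); split=> [n|].
  have [ns|sn] := ltnP n (size s); last by rewrite nth_default//; split.
  by apply: FC; rewrite sE /=; exact: mem_nth.
rewrite -subTset => x _; have [U [FU Ux]] := Fcov x.
rewrite -bigcup_mkord; exists (index U s); last first.
  by rewrite nth_index//; move: FU; rewrite sE.
by rewrite /= index_mem; move: FU; rewrite sE.
Qed.

Variable mu : {measure set (borel dist) -> \bar R}.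
Hypothesis mu_fin : mu setT < +oo.

Lemma economical_small_cover (A : set (borel dist)) r e :
  measurable A -> (0 < r)%R -> (0 < e)%R ->
  exists N (I : nat -> set T), [/\ forall n, small_open r (I n),
    A `<=` \big[setU/set0]_(n < N) I n &
    \sum_(n < N) mu (I n) <= mu A + e%:E].
Proof.
move=> mA r0 e0; have [N [B [smallB BT]]] := finite_small_cover r0.
have mB n : measurable (B n : set (borel dist)).
  by apply: measurable_open; exact: (smallB n).1.
pose P n : set (borel dist) := A `&` seqDU B n.
have mP n : measurable (P n) by apply: measurableI => //; exact: seqDU_measurable.
(* At most [e] is lost over the [N] pieces; the successor covers [N = 0]. *)
pose d : R := (e / N.+1%:R)%R.
have d0 : (0 < d)%R by rewrite divr_gt0.
have /choice[U UP] : forall n, exists U, [/\ metric_open dist U, P n `<=` U &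
    mu U <= mu (P n) + d%:E].
  by move=> n; exact: outer_regular.
(* Intersecting with [B n] restores the diameter bound, which the thickening [U n] may violate. *)
exists N, (fun n => U n `&` B n).
have smallI n : small_open r (U n `&` B n).
  have [oU _ _] := UP n; have [oB dB] := smallB n; split.
    exact: metric_openI.
  by move=> x y [_ Bx] [_ By]; exact: dB.
split=> //.
- move=> x Ax; have : (\big[setU/set0]_(n < N) seqDU B n) x.
    by rewrite -bigsetU_seqDU BT.
  rewrite -bigcup_mkord => -[n nN Bx].
  rewrite -(bigcup_mkord N (fun n => U n `&` B n)); exists n => //.
  split; last exact: subset_seqDU Bx.
  by have [_ + _] := UP n; apply.
- apply: (@le_trans _ _ (\sum_(n < N) (mu (P n) + d%:E))).
    apply: lee_sum => n _; have [oU _ muU] := UP n.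
    apply: le_trans muU; apply: le_measure; rewrite ?inE.
    + by apply: measurable_open; exact: (smallI n).1.
    + exact: measurable_open.
    + exact: subIsetl.
  rewrite big_split/= leeD//.
    rewrite -(measure_semi_additive (s := mu) P) //; last first.
    + exact: bigsetU_measurable.
    + exact/trivIset_setIl/trivIset_seqDU.
    apply: le_measure; rewrite ?inE//; first exact: bigsetU_measurable.
    by rewrite -(bigcup_mkord N P) => x [n _ []].
  rewrite sumEFin lee_fin sumr_const card_ord -mulr_natl /d mulrCA.
  by rewrite ler_piMr ?(ltW e0)// ler_pdivrMr// mul1r ler_nat.
Qed.

End small_covers.

(** * Almost everywhere equality and integrals *)

Lemma addee_squeeze (R : realType) (a b h k : \bar R) (c : R) :
  0 <= a -> 0 <= b -> a <= h -> b <= k -> c%:E <= a + b -> h + k = c%:E -> a = h.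
Proof.
(* Finiteness of [h + k] makes all four terms real; slack in either bound would then push [a + b]
   below [c]. *)
case: a b h k => [a||] [b||] [h||] [k||]//=.
rewrite -!EFinD !lee_fin => a0 b0 ah bk cab [hk]; congr EFin; lra.
Qed.

Section ae_integral.
Context d (T : measurableType d) (R : realType).
Variable mu : {measure set T -> \bar R}.

Lemma ae_eq_1 (g : T -> \bar R) : mu setT < +oo -> measurable_fun setT g ->
  (forall x, 1 <= g x) -> \int[mu]_x g x <= mu setT -> {ae mu, forall x, g x = 1}.
Proof.
move=> mufin mg g1 gmu.
have mg1 : measurable_fun setT (fun x => g x - 1) by exact: emeasurable_funB.
have g10 x : 0 <= g x - 1 by rewrite sube_ge0.
have : \int[mu]_x `|g x - 1| = 0.
  under eq_integral do rewrite gee0_abs//.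
  apply/eqP; rewrite eq_le integral_ge0// andbT.
  move: gmu; rewrite (eq_integral (fun x => (g x - 1) + 1)); last first.
    by move=> x _; rewrite subeK.
  rewrite ge0_integralD// (integral_cst _ _ 1)// mul1e.
  by rewrite -leeBrDr ?subee// ge0_fin_numE.
move=> /(ae_eq_integral_abs mu measurableT mg1).
apply: filterS => x /(_ I) gx; have := congr1 (fun y => y + 1) gx.
by rewrite subeK// add0e.
Qed.

Import HBNNSimple.

Lemma ge0_integral_ae_le (F H : T -> \bar R) :
  (forall x, 0 <= F x) -> (forall x, 0 <= H x) ->
  {ae mu, forall x, F x = H x} -> \int[mu]_x F x <= \int[mu]_x H x.
Proof.
move=> F0 H0 [N [mN N0 FHN]]; rewrite !ge0_integralTE//.
apply: ge_ereal_sup => _ [h hF <-]; apply: ereal_sup_ubound.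
have mNC := measurableC mN.
(* Cut to zero on the null set, the simple function lies below [H] everywhere and keeps its
   integral. *)
exists (proj_nnsfun h mNC).
  move=> x /=; rewrite mindicE; case: (boolP (x \in ~` N)) => [/set_mem Nx|_].
    rewrite mulr1 -(_ : F x = H x)//; apply: contrapT => FHx.
    by apply: Nx; exact: FHN.
  by rewrite mulr0.
rewrite -!integralT_nnsfun; apply: ae_eq_integral => //.
- exact/measurable_EFinP.
- exact/measurable_EFinP.
exists N; split=> // x /= /not_implyP[_ hx]; apply: contrapT => Nx; apply: hx.
by rewrite mindicE mem_set// mulr1.
Qed.

(* No measurability is required: the integral of an arbitrary nonnegative
   function is the supremum of the integrals of the simple functions below. *)
Lemma integral_ae_ext (F H : T -> \bar R) :
  {ae mu, forall x, F x = H x} -> \int[mu]_x F x = \int[mu]_x H x.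
Proof.
move=> FH; rewrite integralE [RHS]integralE; congr (_ - _);
  apply/eqP; rewrite eq_le; apply/andP; split; apply: ge0_integral_ae_le => //;
  by move: FH; apply: filterS => x FHx; rewrite ?(funeposE, funenegE) FHx.
Qed.

End ae_integral.

(** * Integrable majorants and the almost everywhere equality of [nu] and [tau] *)

Lemma limn_einf_ge_near (R : realType) (u : nat -> \bar R) c N :
  (forall n, (N <= n)%N -> c <= u n) -> c <= limn_einf u.
Proof.
move=> cu; rewrite /limn_einf leeNr.
by apply: (@limn_esup_le_near _ _ _ N) => n Nn; rewrite leeN2 cu.
Qed.

Lemma measurable_fun_limn_einf d (T : measurableType d) (R : realType)
    (D : set T) (h : (T -> \bar R)^nat) :
  (forall n, measurable_fun D (h n)) ->
  measurable_fun D (fun x => limn_einf (h ^~ x)).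
Proof.
move=> mh; apply: measurableT_comp => //.
by apply: measurable_fun_limn_esup => n; exact: measurableT_comp.
Qed.

Section frequency_measure.
Context {R : realType} {T : pointedType} (dist : T -> T -> R).
Hypothesis hmet : is_metric dist.
Hypothesis hcpt : metric_compact dist.
Variable f : T -> T.
Hypothesis mf : measurable_fun [set: borel dist] (f : borel dist -> borel dist).
Variable mu : {measure set (borel dist) -> \bar R}.
Hypothesis mu_fin : mu setT < +oo.
Hypothesis mu_inv :
  forall A : set (borel dist), measurable A -> mu (f @^-1` A) = mu A.

Lemma frequency_majorant (A : set (borel dist)) : measurable A ->
  exists h : borel dist -> \bar R, [/\ measurable_fun setT h,
    forall x, tau R f x A <= h x, forall x, nu dist f x A <= h x &
    \int[mu]_x h x <= mu A].
Proof.
move=> mA; pose r k : R := (k.+1%:R^-1)%R.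
have r0 k : (0 < r k)%R by rewrite invr_gt0.
have rlt e : (0 < e)%R -> exists K, forall k, (K <= k)%N -> (r k <= e)%R.
  move=> e0; exists (Num.truncn e^-1) => k Kk.
  rewrite -[leRHS]invrK lef_pV2 ?posrE ?invr_gt0//.
  by rewrite (le_trans (ltW (truncnS_gt _)))// ler_nat ltnS.
have /choice[NI NIP] : forall k, exists NI : nat * (nat -> set T),
    [/\ forall n, small_open dist (r k) (NI.2 n),
    A `<=` \big[setU/set0]_(n < NI.1) NI.2 n &
    \sum_(n < NI.1) mu (NI.2 n) <= mu A + (r k)%:E].
  move=> k.
  have [N [I h]] := economical_small_cover hmet hcpt mu_fin mA (r0 k) (r0 k).
  by exists (N, I).
pose u k (x : borel dist) := \sum_(n < (NI k).1) tau R f x ((NI k).2 n).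
have mI k n : measurable ((NI k).2 n : set (borel dist)).
  by apply: measurable_open; have [/(_ n)[]] := NIP k.
have mu_ k : measurable_fun setT (u k).
  by apply: emeasurable_sum => n; exact: measurable_fun_tau.
have u0 k x : 0 <= u k x by apply: sume_ge0 => n _; exact: tau_ge0.
(* A lower limit is taken so that Fatou's lemma bounds the integral. *)
exists (fun x => limn_einf (u ^~ x)); split.
- exact: measurable_fun_limn_einf.
- move=> x; apply: (@limn_einf_ge_near _ _ _ 0%N) => k _.
  have [_ AI _] := NIP k.
  exact: le_trans (subset_tau _ _ AI) (tau_bigsetU _ _ _ _).
(* For a given scale [s], all covers from some index [K] on are fine enough; each is padded with
   empty sets to a sequence. *)
- move=> x; apply: ge_ereal_sup => _ [s /= /rlt[K Ks] <-].
  apply: (@limn_einf_ge_near _ _ _ K) => k /Ks rks.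
  apply: le_trans (nu_r_antitone _ _ _ _ rks) _.
  have [smallI AI _] := NIP k; apply: ge_ereal_inf.
  pose J n := if (n < (NI k).1)%N then (NI k).2 n else set0.
  exists (\sum_(n <oo) tau R f x (J n)).
    exists J => //; split=> [n|y /AI].
      by rewrite /J; case: ifP => _; [exact: smallI|split].
    rewrite -bigcup_mkord => -[n /= nN Iy]; exists n => //.
    by rewrite /J nN.
  rewrite (nneseries_split 0 (NI k).1); last by move=> n _; exact: tau_ge0.
  rewrite add0n [X in _ + X]eseries0 ?adde0; last first.
    by move=> n Nn _; rewrite /J ltnNge Nn/= tau_set0.
  by rewrite big_mkord; apply: lee_sum => n _; rewrite /J ltn_ord.
- apply: le_trans (fatou mu measurableT mu_ _) _ => //.
  apply: le_trans (limn_einf_sup _) _.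
  apply: lee_of_addgt0 => e /rlt[K Ke].
  apply: (@limn_esup_le_near _ _ _ K) => k /Ke rke.
  rewrite ge0_integral_sum//; last 2 first.
  + by move=> n; exact: measurable_fun_tau.
  + by move=> n x _; exact: tau_ge0.
  have [_ _ muI] := NIP k.
  apply: (@le_trans _ _ (\sum_(n < (NI k).1) mu ((NI k).2 n))).
    by apply: lee_sum => n _; exact: integral_tau_le.
  by apply: le_trans muI _; rewrite leeD2l// lee_fin.
Qed.

Let mu_fin_num (A : set (borel dist)) : measurable A -> mu A \is a fin_num.
Proof.
move=> mA; rewrite ge0_fin_numE// (le_lt_trans _ mu_fin)//.
by rewrite le_measure ?inE.
Qed.

Let mu_setC (A : set (borel dist)) : measurable A ->
  mu A + mu (~` A) = mu setT.
Proof.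
move=> mA; rewrite -measureU ?setICr ?setUCr//; exact: measurableC.
Qed.

(* Both tau and nu are at least 1 on A and its complement together, while
   majorants of A and its complement have total integral mu setT. *)
Lemma frequency_ae (A : set (borel dist)) : measurable A ->
  exists h : borel dist -> \bar R, [/\
    {ae mu, forall x : borel dist, tau R f x A = h x},
    {ae mu, forall x : borel dist, nu dist f x A = h x},
    measurable_fun setT h & \int[mu]_x h x = mu A].
Proof.
move=> mA; have mAC := measurableC mA.
have [h [mh tau_h nu_h int_h]] := frequency_majorant mA.
have [k [mk tau_k nu_k int_k]] := frequency_majorant mAC.
have h0 x : 0 <= h x by exact: le_trans (tau_ge0 _ _ _) (tau_h x).
have k0 x : 0 <= k x by exact: le_trans (tau_ge0 _ _ _) (tau_k x).
have tau1 x : 1 <= tau R f x A + tau R f x (~` A).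
  by rewrite -(tau_setT (R := R) f x) -(setUCr A) tauU.
have nu1 x : 1 <= nu dist f x A + nu dist f x (~` A).
  rewrite (le_trans (nu_setT_ge1 f hcpt x))// -[in leLHS](setUCr A).
  exact: (outer_measureU2 (nu dist f x)).
have hk1 x : 1 <= h x + k x by exact: le_trans (tau1 x) (leeD _ _).
have int_hk : \int[mu]_x (h x + k x) = \int[mu]_x h x + \int[mu]_x k x.
  exact: ge0_integralD.
have hkE : {ae mu, forall x, h x + k x = 1}.
  apply: ae_eq_1 => //; first exact: emeasurable_funD.
  by rewrite int_hk -(mu_setC mA) leeD.
exists h; split=> //.
- apply: filterS hkE => x hkx.
  by apply: (@addee_squeeze _ _ (tau R f x (~` A)) _ (k x) 1) => //; exact: tau_ge0.
- apply: filterS hkE => x hkx.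
  by apply: (@addee_squeeze _ _ (nu dist f x (~` A)) _ (k x) 1) => //; exact: nu_ge0.
(* The same squeeze for the integrals: their bounds [mu A] and the measure of the complement add up
   to the total mass. *)
- apply: (@addee_squeeze _ _ (\int[mu]_x k x) _ (mu (~` A)) (fine (mu setT))) => //.
  + exact: integral_ge0.
  + exact: integral_ge0.
  + rewrite fineK ?mu_fin_num// -int_hk -[leLHS]mul1e -integral_cst//.
    by apply: ge0_le_integral => //; exact: emeasurable_funD.
  + by rewrite fineK ?mu_fin_num// mu_setC.
Qed.

Lemma nu_eq_tau_ae (A : set (borel dist)) : measurable A ->
  {ae mu, forall x : borel dist, nu dist f x A = tau R f x A}.
Proof.
move=> /frequency_ae[h [tau_h nu_h _ _]].
by apply: (filterS2 (ae_filter_ringOfSetsType mu) _ tau_h nu_h) => x -> ->.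
Qed.

Lemma integral_tau (A : set (borel dist)) : measurable A ->
  \int[mu]_x tau R f x A = mu A.
Proof. by move=> /frequency_ae[h [/integral_ae_ext -> _ _]]. Qed.

Lemma integral_nu (A : set (borel dist)) : measurable A ->
  \int[mu]_x nu dist f x A = mu A.
Proof. by move=> /frequency_ae[h [_ /integral_ae_ext -> _]]. Qed.

End frequency_measure.

(** * A countable generating pi-system of open sets *)

Section countable_generators.
Context {R : realType} {T : pointedType} (dist : T -> T -> R).
Hypothesis hmet : is_metric dist.
Hypothesis hcpt : metric_compact dist.

(** Finite covers of mesh [1/(k+1)] are collected over all [k]: a member containing [x] lies in [U]
    once the mesh is small. *)
Lemma countable_basis : exists B : nat * nat -> set T,
  (forall p, metric_open dist (B p)) /\
  (forall U x, metric_open dist U -> U x -> exists2 p, B p x & B p `<=` U).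
Proof.
have r0 k : (0 < k.+1%:R^-1 :> R)%R by rewrite invr_gt0.
have /choice[B BP] : forall k, exists B : nat -> set T,
    (forall n, small_open dist k.+1%:R^-1 (B n)) /\ \bigcup_n B n = setT.
  move=> k; have [N [B [sB BT]]] := finite_small_cover hmet hcpt (r0 k).
  exists B; split=> //; rewrite -subTset -BT; exact: bigsetU_bigcup.
exists (fun p => B p.1 p.2); split=> [p|U x oU /oU[e [e0 eU]]].
  by have [/(_ p.2)[]] := BP p.1.
pose k := Num.truncn e^-1; have [sB BT] := BP k.
have [n _ Bx] : (\bigcup_n B k n) x by rewrite BT.
exists (k, n) => // y By; apply: eU.
apply: le_lt_trans ((sB n).2 _ _ Bx By) _.
by rewrite -[ltRHS]invrK ltf_pV2 ?posrE ?invr_gt0// truncnS_gt.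
Qed.

(** Finite intersections of basis sets are coded by lists: concatenation gives intersections, and
    the empty list, also used for numbers without a code, gives the whole space. *)
Lemma countable_pi_system : exists C : nat -> set (borel dist),
  [/\ forall n, metric_open dist (C n), exists n, C n = setT,
   setI_closed (range C) & measurable = <<s range C >>].
Proof.
have [B [oB basisB]] := countable_basis.
pose D (s : seq (nat * nat)) := \big[setI/setT]_(p <- s) B p.
have oD s : metric_open dist (D s).
  rewrite /D; elim: s => [|p s IHs]; first by rewrite big_nil; exact: metric_openT.
  by rewrite big_cons; exact: metric_openI.
pose u n : seq (nat * nat) := odflt [::] (unpickle n).
pose C n : set (borel dist) := D (u n).
have CD s : C (pickle s) = D s by rewrite /C /u pickleK.
have oC n : metric_open dist (C n) by exact: oD.
exists C; split=> //.
- by exists (pickle ([::] : seq (nat * nat))); rewrite CD /D big_nil.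
- move=> _ _ [m _ <-] [n _ <-].
  exists (pickle (u m ++ u n)) => //.
  by rewrite CD /D big_cat.
apply/seteqP; split; last first.
  apply: smallest_sub; first exact: sigma_algebra_measurable.
  by move=> _ [n _ <-]; exact: measurable_open.
apply: smallest_sub; first exact: smallest_sigma_algebra.
move=> U oU; have -> : U = \bigcup_n (if `[< C n `<=` U >] then C n else set0).
  apply/seteqP; split=> [x Ux|x [n _]]; last first.
    by case: ifPn => // /asboolP; exact.
  have [p Bx BU] := basisB U x oU Ux.
  have Cp : C (pickle [:: p]) = B p by rewrite CD /D big_seq1.
  by exists (pickle [:: p]) => //; rewrite Cp ifT//; exact/asboolP.
apply: (@bigcupT_measurable _ (g_sigma_algebraType (range C))) => n.
by case: ifPn => // _; apply: sub_sigma_algebra; exists n.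
Qed.

End countable_generators.

(** * Invariance and ergodicity from countably many conditions *)

Section ergodicity.
Context {R : realType} {T : pointedType} (dist : T -> T -> R).
Variable f : T -> T.
Hypothesis mf : measurable_fun [set: borel dist] (f : borel dist -> borel dist).
Variable C : nat -> set (borel dist).
Hypothesis oC : forall n, metric_open dist (C n).
Hypothesis CT : exists n, C n = setT.
Hypothesis CI : setI_closed (range C).
Hypothesis sC : measurable = <<s range C >>.

Lemma pi_measure_unique (m1 m2 : {measure set (borel dist) -> \bar R}) :
  m1 setT < +oo -> (forall n, m1 (C n) = m2 (C n)) ->
  forall A, measurable A -> m1 A = m2 A.
Proof.
move=> m1fin m12; apply: (measure_unique (range C) (fun=> setT)) => //.
- by move=> _; have [n Cn] := CT; exists n.
- by rewrite bigcup_const.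
- by move=> _ [n _ <-].
Qed.

Variable m : {measure set (borel dist) -> \bar R}.
Hypothesis m1 : m setT = 1.

Let mC n : measurable (C n). Proof. exact: measurable_open. Qed.

Let m_fin : m setT < +oo. Proof. by rewrite m1 ltry. Qed.

Let m_fin_num A : measurable A -> m A \is a fin_num.
Proof.
move=> mA; rewrite ge0_fin_numE// (le_lt_trans _ m_fin)//.
by rewrite le_measure ?inE.
Qed.

Let m_setC (A : set (borel dist)) : measurable A -> m A + m (~` A) = 1.
Proof. by move=> mA; rewrite -measureU ?setICr ?setUCr//; exact: measurableC. Qed.

Lemma invariant_of_generators : (forall n, m (f @^-1` C n) = m (C n)) ->
  forall A : set (borel dist), measurable A -> m (f @^-1` A) = m A.
Proof.
move=> mfC; apply: (@pi_measure_unique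
  (measure_function_pushforward__canonical__measure_function_Measure m mf) m).
- exact: m_fin.
- exact: mfC.
Qed.

Hypothesis m_inv :
  forall A : set (borel dist), measurable A -> m (f @^-1` A) = m A.
(** This encodes [tau R f y (C n) >= m (C n)] for [m]-almost every [y] through countably many
    rational levels. *)
Hypothesis m_level : forall n (q : rat), (ratr q)%:E < m (C n) ->
  m [set y | (ratr q)%:E < tau R f y (C n)] = 1.

Let measurable_level n (c : R) :
  measurable ([set y | c%:E < tau R f y (C n)] : set (borel dist)).
Proof.
rewrite -[X in measurable X]setTI; apply: emeasurable_fun_o_infty => //.
exact: (measurable_fun_tau mf).
Qed.

Let invariant_mul_le (A : set (borel dist)) n : measurable A -> f @^-1` A = A ->
  m A * m (C n) <= m (A `&` C n).
Proof.
move=> mA fA; have mAC := measurableI _ _ mA (mC n).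
rewrite -(fineK (m_fin_num mA)) -(fineK (m_fin_num (mC n))).
rewrite -(fineK (m_fin_num mAC)) -EFinM lee_fin leNgt; apply/negP.
set a := fine (m A); set b := fine (m (C n)); set c := fine _ => cab.
have c0 : (0 <= c)%R by rewrite fine_ge0.
have a0 : (0 < a)%R.
  rewrite lt_neqAle fine_ge0// andbT; apply/eqP => a0; move: cab.
  by rewrite -a0 mul0r ltNge c0.
(* If the inequality failed, a rational [q] would fit strictly between [m (A & C n) / m A] and
   [m (C n)], writing [&] for intersection. *)
have : (c / a < b)%R by rewrite ltr_pdivrMr// mulrC.
move=> /rat_in_itvoo[q]; rewrite in_itv/= => /andP[cq qb].
have q0 : (0 <= ratr q :> R)%R by rewrite (le_trans _ (ltW cq))// divr_ge0// ltW.
pose S : set (borel dist) := [set y | (ratr q)%:E < tau R f y (C n)].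
have mS : m S = 1.
  by apply: m_level; rewrite -(fineK (m_fin_num (mC n))) lte_fin.
have mS_ : measurable S by exact: measurable_level.
have AS : m (A `&` S) = m A.
  rewrite [RHS](measureDI m mA mS_)//.
  rewrite [X in _ = X + _](_ : _ = 0) ?add0e//.
  apply/eqP; rewrite eq_le measure_ge0 andbT.
  apply: (@le_trans _ _ (m (~` S))).
    apply: le_measure; rewrite ?inE.
    - exact: measurableD.
    - exact: measurableC.
    - by move=> ? [].
  have := m_setC mS_; rewrite mS addeC => /(congr1 (fun z => z - 1)).
  by rewrite addeK// subee// => ->.
(* Orbits starting in [A] stay there, so on [S] they visit the intersection with frequency above
   [q]; Birkhoff's inequality for [m] bounds the integral. *)
have : (ratr q)%:E * m (A `&` S) <= m (A `&` C n).
  apply: le_trans (integral_tau_le mf m_fin m_inv mAC).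
  have mAS := measurableI _ _ mA mS_.
  rewrite -(setIT (A `&` S)) -integral_indic// -ge0_integralZl_EFin//; last first.
    by apply/measurable_EFinP; exact: measurable_indic.
  apply: ge0_le_integral => //.
  - by move=> y _; rewrite mule_ge0 ?lee_fin.
  - apply: measurable_funeM; apply/measurable_EFinP; exact: measurable_indic.
  - exact: (measurable_fun_tau mf).
  move=> y _; rewrite indicE; case: (boolP (y \in _)) => [/set_mem[Ay Sy]|_].
    by rewrite mule1 tau_setI_invariant// ltW.
  by rewrite mule0 tau_ge0.
rewrite AS -(fineK (m_fin_num mA)) -(fineK (m_fin_num mAC)) -EFinM lee_fin.
by rewrite leNgt -ltr_pdivrMr// cq.
Qed.

(** The inequalities for [A] and for its complement add up to the identity [m (C n) = m (C n)], so
    both are equalities. *)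
Let invariant_mul (A : set (borel dist)) n : measurable A -> f @^-1` A = A ->
  m (C n `&` A) = m A * m (C n).
Proof.
move=> mA fA; apply/esym; rewrite setIC.
have mAC := measurableC mA.
have fAC : f @^-1` (~` A) = ~` A by rewrite -preimage_setC fA.
have eC : m (C n) = m (A `&` C n) + m (~` A `&` C n).
  rewrite (measureDI m (mC n) mA) addeC; congr (m _ + m _).
    by rewrite setIC.
  by rewrite setDE setIC.
have eT := m_setC mA.
have le1 := invariant_mul_le n mA fA.
have le2 := invariant_mul_le n mAC fAC.
move: eC eT le1 le2.
rewrite -(fineK (m_fin_num mA)) -(fineK (m_fin_num mAC)).
rewrite -(fineK (m_fin_num (mC n))).
rewrite -(fineK (m_fin_num (measurableI _ _ mA (mC n)))).
rewrite -(fineK (m_fin_num (measurableI _ _ mAC (mC n)))).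
rewrite -!EFinD -!EFinM !lee_fin => -[eC] [eT] le1 le2; congr EFin.
apply/eqP; rewrite eq_le le1/=; move: eC eT le2 {le1}.
set a := fine (m A); set b := fine (m (C n)); set a' := fine (m (~` A)).
move=> eC eT; have -> : a' = (1 - a)%R by rewrite -eT addrAC subrr add0r.
by rewrite mulrBl mul1r eC; lra.
Qed.

(** The restriction of [m] to [A] and the multiple [m A] of [m] agree on the pi-system, hence at [A]
    itself, so [m A] equals its square. *)
Lemma ergodic_of_levels (A : set (borel dist)) :
  measurable A -> f @^-1` A = A -> m A = 0 \/ m A = 1.
Proof.
move=> mA fA; have a0 : (0 <= fine (m A))%R by rewrite fine_ge0.
have : mrestr m mA A = mscale (NngNum a0) m A.
  apply: pi_measure_unique => //.
    have : m (setT `&` A) < +oo by rewrite setTI -ge0_fin_numE// m_fin_num.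
    by [].
  move=> n; rewrite /mrestr/= /mscale/= fineK ?m_fin_num//.
  exact: invariant_mul.
rewrite /mrestr/= /mscale/= setIid -(fineK (m_fin_num mA)) -EFinM => -[].
set a := fine _ => aa.
have : (a * (1 - a) == 0)%R by rewrite mulrBr mulr1 {1}aa/= subrr.
rewrite mulf_eq0 subr_eq0 => /orP[/eqP->|/eqP<-]; by [left|right].
Qed.

End ergodicity.

(** * Disintegration of integrals along a family of measures *)

Lemma ae_forall_countable d (T : measurableType d) (R : realType)
    (mu : {measure set T -> \bar R}) (I : countType) (P : I -> T -> Prop) :
  (forall i, {ae mu, forall x, P i x}) -> {ae mu, forall x, forall i, P i x}.
Proof.
move=> aeP; have : {ae mu, forall x, forall n,
    if unpickle n is Some i then P i x else True}.
  apply: ae_foralln => n; case: (unpickle n) => [i|]; first exact: aeP.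
  exact: aeW.
by apply: filterS => x Px i; have := Px (pickle i); rewrite pickleK.
Qed.

Section kernel_integral.
Context d (T : measurableType d) (R : realType).
Variable mu : {measure set T -> \bar R}.
Variable m : T -> {measure set T -> \bar R}.
(** A measurable substitute for [m], equal to it off a null set that may depend on the set; in the
    theorem it is [tau]. *)
Variable t : T -> set T -> \bar R.
Hypothesis t_ge0 : forall x A, 0 <= t x A.
Hypothesis measurable_t : forall A, measurable A -> measurable_fun setT (t ^~ A).
Hypothesis integral_t : forall A, measurable A -> \int[mu]_x t x A = mu A.
Hypothesis m_t : forall A, measurable A -> {ae mu, forall x, m x A = t x A}.

Import HBNNSimple.

(** A simple function has finitely many level sets, so the exceptional null sets of [m_t] can be
    united. *)
Let nnsfun_disintegration (h : {nnsfun T >-> R}) :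
  exists H : T -> \bar R, [/\ measurable_fun setT H, forall x, 0 <= H x,
    {ae mu, forall x, \int[m x]_y (h y)%:E = H x} &
    \int[mu]_x H x = \int[mu]_x (h x)%:E].
Proof.
(* One list serves all measures [l]; [|r|] equals [r] on the range of [h] and makes each summand
   nonnegative for every [r]. *)
have [s sE] : exists s : seq R, forall l : {measure set T -> \bar R},
    \int[l]_y (h y)%:E = \sum_(r <- s) `|r|%:E * l (h @^-1` [set r]).
  exists (finmap.enum_fset (fset_set (range h))) => l.
  rewrite integralT_nnsfun sintegralE fsbig_finite//=; apply: eq_big_seq => r.
  by rewrite in_fset_set// inE => -[y _ <-]; rewrite ger0_norm.
have mh (r : R) : measurable (h @^-1` [set r]) by [].
have mt (r : R) : measurable_fun setT (fun x => `|r|%:E * t x (h @^-1` [set r])).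
  by apply: measurable_funeM; exact: measurable_t.
have t0 r x : 0 <= `|r|%:E * t x (h @^-1` [set r]) by rewrite mule_ge0 ?lee_fin.
exists (fun x => \sum_(r <- s) `|r|%:E * t x (h @^-1` [set r])); split.
- exact: emeasurable_sum.
- by move=> x; apply: sume_ge0.
- have : {ae mu, forall x, forall i : 'I_(size s),
      m x (h @^-1` [set s`_i]) = t x (h @^-1` [set s`_i])}.
    by apply: ae_forall_countable => i; exact: m_t.
  apply: filterS => x mx; rewrite sE; apply: eq_big_seq => r rs.
  have ri : (index r s < size s)%N by rewrite index_mem.
  by have := mx (Ordinal ri); rewrite /= nth_index// => ->.
- rewrite ge0_integral_sum// sE; apply: eq_bigr => r _.
  by rewrite ge0_integralZl_EFin// ?integral_t//; exact: measurable_t.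
Qed.

Let ge0_disintegration (phi : T -> \bar R) :
  measurable_fun setT phi -> (forall x, 0 <= phi x) ->
  exists H : T -> \bar R, [/\ measurable_fun setT H, forall x, 0 <= H x,
    {ae mu, forall x, \int[m x]_y phi y = H x} &
    \int[mu]_x H x = \int[mu]_x phi x].
Proof.
move=> mphi phi0; pose h := nnsfun_approx measurableT mphi.
have mono (l : {measure set T -> \bar R}) :
    \int[l]_y phi y = limn (fun n => \int[l]_y (h n y)%:E).
  rewrite -monotone_convergence//.
  - apply: eq_integral => y _; apply/esym/cvg_lim => //.
    exact: cvg_nnsfun_approx.
  - by move=> n; exact/measurable_EFinP.
  - by move=> n y _; rewrite lee_fin.
  - by move=> y _ a b ab; rewrite lee_fin; exact/lefP/nd_nnsfun_approx.
have /choice[H HP] := fun n => nnsfun_disintegration (h n).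
have : {ae mu, forall x, forall n, \int[m x]_y (h n y)%:E = H n x}.
  by apply: ae_foralln => n; have [] := HP n.
move=> [N [mN N0 NP]]; have mNC := measurableC mN.
have HE x n : ~ N x -> H n x = \int[m x]_y (h n y)%:E.
  by move=> Nx; apply/esym; move: n; apply: contrapT => ?; exact: Nx (NP _ _).
have mH n : measurable_fun setT (H n) by have [] := HP n.
have H0 n x : 0 <= H n x by have [] := HP n.
(* Setting [H n] to zero on the null set makes the sequence monotone everywhere, as monotone
   convergence requires here. *)
pose G n := H n \_ (~` N).
have mG n : measurable_fun setT (G n).
  by apply/(measurable_restrictT _ mNC); exact: measurable_funTS.
have G0 n x : 0 <= G n x by apply: erestrict_ge0.
have ndG x : nondecreasing_seq (G ^~ x).
  move=> a b ab; rewrite /G !patchE; case: ifPn => // /set_mem Nx.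
  rewrite !HE//; apply: ge0_le_integral => //.
  - by move=> y _; rewrite lee_fin.
  - exact/measurable_EFinP.
  - exact/measurable_EFinP.
  - by move=> y _; rewrite lee_fin; exact/lefP/nd_nnsfun_approx.
exists (fun x => limn (G ^~ x)); split.
- apply: (emeasurable_fun_cvg G) => // x _.
  exact: ereal_nondecreasing_is_cvgn.
- move=> x; apply: lime_ge; first exact: ereal_nondecreasing_is_cvgn.
  exact: nearW.
- exists N; split=> // x /= hx; apply: contrapT => Nx; apply: hx.
  rewrite mono; congr (limn _); apply/funext => n.
  by rewrite /G patchE mem_set// HE.
- rewrite monotone_convergence// mono; congr (limn _); apply/funext => n.
  have [_ _ _ <-] := HP n; apply: integral_ae_ext.
  exists N; split=> // x /= hx; apply: contrapT => Nx; apply: hx.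
  by rewrite /G patchE mem_set.
Qed.

(** Positive and negative parts are treated separately; integrability of [phi] makes both majorised
    integrals finite, so they may be subtracted. *)
Lemma disintegration (phi : T -> R) : mu.-integrable setT (EFin \o phi) ->
  \int[mu]_x (phi x)%:E = \int[mu]_x (\int[m x]_y (phi y)%:E).
Proof.
move=> iphi; have mphi := measurable_int mu iphi.
have [P [mP P0 PE intP]] := ge0_disintegration (measurable_funepos mphi)
  (funepos_ge0 _).
have [Q [mQ Q0 QE intQ]] := ge0_disintegration (measurable_funeneg mphi)
  (funeneg_ge0 _).
have iP : mu.-integrable setT P.
  apply/integrableP; split=> //; under eq_integral do rewrite gee0_abs//.
  by rewrite intP; exact: integral_funepos_lt_pinfty iphi.
have iQ : mu.-integrable setT Q.
  apply/integrableP; split=> //; under eq_integral do rewrite gee0_abs//.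
  by rewrite intQ; exact: integral_funeneg_lt_pinfty iphi.
rewrite [LHS]integralE -intP -intQ -integralB//; apply/esym/integral_ae_ext.
apply: (filterS2 _ _ PE QE) => x Px Qx.
by rewrite [LHS]integralE Px Qx.
Qed.

End kernel_integral.

Theorem theoremA (R : realType) (T : pointedType) (dist : T -> T -> R)
  (hmet : is_metric dist) (hcpt : metric_compact dist)
  (hperf : metric_perfect dist)
  (f : T -> T)
  (hf : measurable_fun [set: borel dist] (f : borel dist -> borel dist))
  (mu : {measure set (borel dist) -> \bar R})
  (hfin : mu [set: borel dist] < +oo)
  (hinv : forall A : set (borel dist), measurable A -> mu (f @^-1` A) = mu A) :
  {ae mu, forall x : borel dist,
     @invariant_ergodic_probability R T dist f (nu dist f x)} /\
  (exists m : borel dist -> {measure set (borel dist) -> \bar R},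
     forall x (A : set (borel dist)), measurable A -> m x A = nu dist f x A) /\
  (forall m : borel dist -> {measure set (borel dist) -> \bar R},
     (forall x (A : set (borel dist)), measurable A -> m x A = nu dist f x A) ->
     forall phi : borel dist -> R, mu.-integrable [set: borel dist] (EFin \o phi) ->
     \int[mu]_x (phi x)%:E = \int[mu]_x (\int[m x]_y (phi y)%:E)) /\
  (forall V : set (borel dist), measurable V ->
     mu V = \int[mu]_x nu dist f x V).
Proof.
split; [|split; [|split]].
- have [C [oC CT CI sC]] := countable_pi_system hmet hcpt.
  have mC n : measurable (C n) by exact: measurable_open.
  pose level n (q : rat) : set (borel dist) :=
    [set y | (ratr q)%:E < tau R f y (C n)].
  have mlevel n q : measurable (level n q).
    rewrite -[X in measurable X]setTI; apply: emeasurable_fun_o_infty => //.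
    exact: (measurable_fun_tau hf).
  have ae_nu A (mA : measurable A) := nu_eq_tau_ae hmet hcpt hf hfin hinv mA.
  have ae1 : {ae mu, forall x : borel dist, forall n,
      nu dist f x (C n) = tau R f x (C n)}.
    by apply: ae_foralln => n; exact: ae_nu.
  have ae2 : {ae mu, forall x : borel dist, forall n,
      nu dist f x (f @^-1` C n) = tau R f x (f @^-1` C n)}.
    apply: ae_foralln => n; apply: ae_nu.
    by rewrite -[X in measurable X]setTI; exact: hf.
  have ae3 : {ae mu, forall x : borel dist, forall p : nat * rat,
      nu dist f x (level p.1 p.2) = tau R f x (level p.1 p.2)}.
    by apply: ae_forall_countable => p; exact: ae_nu.
  apply: (filterS3 _ _ ae1 ae2 ae3) => x nuC nufC nulevel.
  pose m : {measure set (borel dist) -> \bar R} := nu_measure hmet f x.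
  have m1 : m setT = 1.
    by have [n Cn] := CT; rewrite -Cn [LHS]nuC Cn tau_setT.
  have m_inv : forall A : set (borel dist), measurable A -> m (f @^-1` A) = m A.
    apply: (invariant_of_generators hf CT CI sC m1) => n.
    (* Invariance on the generators comes from that of [tau]. *)
    by rewrite [LHS]nufC tau_preimage -nuC.
  split; split.
  + exact: nu0.
  + by move=> A _; exact: nu_ge0.
  + exact: (@measure_semi_sigma_additive _ _ _ m).
  + exact: m1.
  + exact: m_inv.
  + apply: (ergodic_of_levels hf oC CT CI sC m1 m_inv) => n q qC.
    have flevel : f @^-1` level n q = level n q.
      by apply/seteqP; split=> y; rewrite /level /= tau_shift.
    (* On an invariant set [tau] at [x] is the indicator, and [x] lies in the level set because
       [tau] and [nu] agree there on [C n]. *)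
    rewrite [LHS](nulevel (n, q)) tau_invariant// indicE mem_set//.
    by rewrite /level /= -nuC.
- by exists (fun x => nu_measure hmet f x).
- move=> m mE phi; apply: (@disintegration _ _ _ mu m (fun x A => tau R f x A)).
  + by move=> x A; exact: tau_ge0.
  + by move=> A mA; exact: (measurable_fun_tau hf).
  + by move=> A mA; exact: (integral_tau hmet hcpt hf hfin hinv).
  + move=> A mA; have := nu_eq_tau_ae hmet hcpt hf hfin hinv mA.
    by apply: filterS => x; rewrite mE.
- by move=> V mV; rewrite (integral_nu hmet hcpt hf hfin hinv).
Qed.
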